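(* Let $X$ be a compact space. Then the following conditions are equivalent for the algebra $C(X)$ of continuous complex-valued functions on $X$: (i) $C(X)$ has open multiplication; (ii) $C(X)$ has uniformly open multiplication; (iii) the covering dimension of $X$ is at most $1$. Moreover, the algebras $C(X)$ have equi-uniformly open multiplications for all compact spaces $X$ of (covering) dimension at most $1$.
   Context: Compact spaces are assumed to be Hausdorff. $C(X)$ carries the supremum norm, and $C(X)\times C(X)$ the maximum norm. A Banach algebra $A$ has open multiplication if the map $m\colon A\times A\to A$, $m(a,b)=ab$, maps open sets to open sets. It has uniformly open multiplication if $m$ is uniformly open, i.e. for every $\varepsilon>0$ there is $\delta>0$ such that for all $(a,b)\in A\times A$ one has $m(B((a,b),\varepsilon))\supseteq B(ab,\delta)$. A class of Banach algebras has equi-uniformly open multiplications if the $\delta=\delta(\varepsilon)$ in the definition of uniform openness can be chosen depending only on $\varepsilon$ and common to all algebras in the class. *)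

(* Defs.v *)
From HB Require Import structures.
From mathcomp Require Import all_boot all_order all_algebra.
From mathcomp Require Import lra.
From mathcomp Require Export complex.
From mathcomp Require Export all_classical all_reals all_analysis.

Set Implicit Arguments.
Unset Strict Implicit.
Unset Printing Implicit Defensive.

Import Order.TTheory GRing.Theory Num.Theory.
Import numFieldNormedType.Exports.

Local Open Scope classical_set_scope.
Local Open Scope ring_scope.
Local Open Scope complex_scope.
Local Open Scope card_scope.

HB.mixin Record isCompactHausdorff X of Topological X := {
  space_compact : compact [set: X];
  space_hausdorff : hausdorff_space X }.

#[short(type="compactHausdorffType")]
HB.structure Definition CompactHausdorff :=
  { X of Topological X & isCompactHausdorff X }.

(* The product is an operation of its own because a common substructure of    *)
(* normed modules and the library's rings cannot be declared on top of the     *)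
(* existing hierarchy. No unit is assumed.                                     *)
HB.mixin Record isBanachAlgebra (K : numFieldType) A
    of CompleteNormedModule K A := {
  bmul : A -> A -> A;
  bmulA : associative bmul;
  bmulDl : left_distributive bmul +%R;
  bmulDr : right_distributive bmul +%R;
  bscaleAl : forall (k : K) (a b : A), k *: bmul a b = bmul (k *: a) b;
  bscaleAr : forall (k : K) (a b : A), k *: bmul a b = bmul a (k *: b);
  bmul_norm_le : forall a b : A, `|bmul a b| <= `|a| * `|b| }.

#[short(type="banachAlgType")]
HB.structure Definition BanachAlgebra (K : numFieldType) :=
  { A of CompleteNormedModule K A & isBanachAlgebra K A }.

Section Multiplication.
Context {K : numFieldType}.

Definition mulmap (A : banachAlgType K) (p : A * A) : A := bmul p.1 p.2.

(* [A * A] carries the library's product norm, which is the maximum norm.      *)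
(* Radii range over [K]; for [K = R[i]] the order of [K] is partial and        *)
(* [0 < e] forces [e] to be a positive real.                                   *)
Definition open_multiplication (A : banachAlgType K) : Prop :=
  forall U : set (A * A), open U -> open (@mulmap A @` U).

Definition mult_modulus (A : banachAlgType K) (e d : K) : Prop :=
  forall p : A * A, ball (mulmap p) d `<=` @mulmap A @` ball p e.

Definition uniformly_open_multiplication (A : banachAlgType K) : Prop :=
  forall e : K, 0 < e -> exists2 d : K, 0 < d & mult_modulus A e d.

(* A class of algebras is presented as a family over an arbitrary type.        *)
Definition equi_uniformly_open_multiplications (I : Type)
    (A : I -> banachAlgType K) : Prop :=
  forall e : K, 0 < e ->
    exists2 d : K, 0 < d & forall i : I, mult_modulus (A i) e d.

End Multiplication.

Definition open_cover (X : topologicalType) (U : set (set X)) : Prop :=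
  U `<=` open /\ \bigcup_(A in U) A = [set: X].

Definition refines (X : Type) (V U : set (set X)) : Prop :=
  forall B, V B -> exists2 A, U A & B `<=` A.

(* [dim X <= n]: every finite open cover has a finite open refinement such     *)
(* that each point lies in at most [n + 1] of its members.                     *)
Definition covering_dim_le (n : nat) (X : topologicalType) : Prop :=
  forall U : set (set X), finite_set U -> open_cover U ->
  exists V : set (set X), [/\ finite_set V, open_cover V, refines V U &
    forall x : X, [set B | V B /\ B x] #<= `I_n.+1].

(* [continuousType] is renamed because the library already puts other          *)
(* topologies on it.                                                           *)
Definition contC (R : realType) (X : topologicalType) : Type :=
  continuousType X R[i]^o.

Section ContC.
Context {R : realType}.

Section Algebra.
Context {X : topologicalType}.
Implicit Types f g h : contC R X.

HB.instance Definition _ :=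
  Choice.copy (contC R X) (continuousType X R[i]^o).

Definition mk_contC (f : X -> R[i]^o) (cf : continuous f) : contC R X :=
  (mkcts cf : continuousType X R[i]^o).

Lemma contC_continuous f : continuous (f : X -> R[i]^o).
Proof. exact: (@cts_fun _ _ (f : continuousType X R[i]^o)). Qed.

Lemma contC_eq f g : f =1 g -> f = g.
Proof. by move=> fg; apply/(@continuousEP X R[i]^o). Qed.

Fact contC_add_subproof f g : continuous (fun x => f x + g x).
Proof.
by move=> x; apply: (@continuousD _ R[i]^o X f g); exact: contC_continuous.
Qed.
Fact contC_opp_subproof f : continuous (fun x => - f x).
Proof.
by move=> x; apply: (@continuousN _ R[i]^o X f); exact: contC_continuous.
Qed.
Fact contC_mul_subproof f g : continuous (fun x => f x * g x).
Proof.
move=> x; apply: (@continuousM R[i] X f g); exact: contC_continuous.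
Qed.
Fact contC_scale_subproof (k : R[i]) f : continuous (fun x => k *: f x).
Proof.
move=> x; apply: (@continuousZ R[i] R[i]^o X (cst k) f).
  exact: cst_continuous.
exact: contC_continuous.
Qed.
Fact contC_cst_subproof (k : R[i]^o) : continuous (fun _ : X => k).
Proof. exact: cst_continuous. Qed.

Definition contC_add f g := mk_contC (@contC_add_subproof f g).
Definition contC_opp f := mk_contC (@contC_opp_subproof f).
Definition contC_mul f g := mk_contC (@contC_mul_subproof f g).
Definition contC_scale k f := mk_contC (@contC_scale_subproof k f).
Definition contC_cst k := mk_contC (@contC_cst_subproof k).

Fact contC_addA : associative contC_add.
Proof. by move=> f g h; apply: contC_eq => x; exact: addrA. Qed.
Fact contC_addC : commutative contC_add.
Proof. by move=> f g; apply: contC_eq => x; exact: addrC. Qed.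
Fact contC_add0 : left_id (contC_cst 0) contC_add.
Proof. by move=> f; apply: contC_eq => x; exact: add0r. Qed.
Fact contC_addN : left_inverse (contC_cst 0) contC_opp contC_add.
Proof. by move=> f; apply: contC_eq => x; exact: addNr. Qed.

HB.instance Definition _ := GRing.isZmodule.Build (contC R X)
  contC_addA contC_addC contC_add0 contC_addN.

Fact contC_mulA : associative contC_mul.
Proof. by move=> f g h; apply: contC_eq => x; exact: mulrA. Qed.
Fact contC_mulC : commutative contC_mul.
Proof. by move=> f g; apply: contC_eq => x; exact: mulrC. Qed.
Fact contC_mul1 : left_id (contC_cst 1) contC_mul.
Proof. by move=> f; apply: contC_eq => x; exact: mul1r. Qed.
Fact contC_mulDl : left_distributive contC_mul contC_add.
Proof. by move=> f g h; apply: contC_eq => x; exact: mulrDl. Qed.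

HB.instance Definition _ := GRing.Zmodule_isComPzRing.Build (contC R X)
  contC_mulA contC_mulC contC_mul1 contC_mulDl.

Fact contC_scaleA (k l : R[i]) f :
  contC_scale k (contC_scale l f) = contC_scale (k * l) f.
Proof. by apply: contC_eq => x; exact: scalerA. Qed.
Fact contC_scale1 : left_id 1 contC_scale.
Proof. by move=> f; apply: contC_eq => x; exact: scale1r. Qed.
Fact contC_scaleDr : right_distributive contC_scale +%R.
Proof. by move=> k f g; apply: contC_eq => x; exact: scalerDr. Qed.
Fact contC_scaleDl f : {morph contC_scale^~ f : k l / k + l}.
Proof. by move=> k l; apply: contC_eq => x; exact: scalerDl. Qed.

HB.instance Definition _ := GRing.Zmodule_isLmodule.Build _ (contC R X)
  contC_scaleA contC_scale1 contC_scaleDr contC_scaleDl.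

Lemma contC_addE f g x : (f + g) x = f x + g x. Proof. by []. Qed.
Lemma contC_oppE f x : (- f) x = - f x. Proof. by []. Qed.
Lemma contC_subE f g x : (f - g) x = f x - g x. Proof. by []. Qed.
Lemma contC_mulE f g x : (f * g) x = f x * g x. Proof. by []. Qed.
Lemma contC_scaleE k f x : (k *: f) x = k * f x. Proof. by []. Qed.
Lemma contC_zeroE x : (0 : contC R X) x = 0. Proof. by []. Qed.
Lemma contC_oneE x : (1 : contC R X) x = 1. Proof. by []. Qed.

End Algebra.

Section Norm.
Context {X : compactHausdorffType}.
Implicit Types f g h : contC R X.

(* [sup set0 = 0], so the norm is [0] when [X] is empty.                       *)
Definition supnorm f : R := sup (range (fun x => Normc.normc (f x))).

Lemma normc_normE (z : R[i]^o) : `|z| = (Normc.normc z)%:C.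
Proof. by []. Qed.

Lemma normc_ge0 (z : R[i]) : 0 <= Normc.normc z.
Proof. by case: z => a b; exact: sqrtr_ge0. Qed.

Lemma normc_continuous : continuous (@Normc.normc R : R[i]^o -> R).
Proof.
move=> z A /nbhs_ballP[e /= e0 eA]; apply/nbhs_ballP; exists e%:C => /=.
  by rewrite ltcR.
move=> w; rewrite -ball_normE/= normc_normE ltcR => zw.
apply: eA; rewrite -ball_normE/=.
apply: le_lt_trans zw.
have tri (a b : R[i]) : Normc.normc a - Normc.normc b <= Normc.normc (a - b).
  by rewrite lerBlDr -{1}(subrK b a) le_normcD.
rewrite ler_norml tri andbT lerNl opprB.
by rewrite -(normcN (z - w)) opprB tri.
Qed.

Lemma supnorm_has_ubound f :
  has_ubound (range (fun x => Normc.normc (f x))).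
Proof.
have /compact_bounded[M [_ hM]] :
    compact (range (fun x => Normc.normc (f x)) : set R).
  apply: continuous_compact; last exact: space_compact.
  apply: continuous_subspaceT => x; apply: continuous_comp.
    exact: contC_continuous.
  exact: normc_continuous.
exists (M + 1) => _ [x _ <-].
by apply: le_trans (ler_norm _) _; apply: hM; [rewrite ltrDl|exists x].
Qed.

Lemma normc_le_supnorm f x : Normc.normc (f x) <= supnorm f.
Proof. by apply: (ub_le_sup (supnorm_has_ubound f)); exists x. Qed.

Lemma supnorm_le f (e : R) :
  0 <= e -> (forall x, Normc.normc (f x) <= e) -> supnorm f <= e.
Proof.
move=> e0 fe; rewrite /supnorm.
have [->|/set0P ne] := eqVneq (range (fun x => Normc.normc (f x))) set0.
  by rewrite sup0.
by apply: ge_sup => // _ [x _ <-].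
Qed.

Lemma supnorm_ge0 f : 0 <= supnorm f.
Proof.
rewrite /supnorm.
have [->|/set0P[_ [x _ _]]] := eqVneq (range (fun x => Normc.normc (f x))) set0.
  by rewrite sup0.
exact: le_trans (normc_ge0 _) (normc_le_supnorm f x).
Qed.

Definition contC_norm f : R[i] := (supnorm f)%:C.

Fact contC_normD f g : contC_norm (f + g) <= contC_norm f + contC_norm g.
Proof.
rewrite /contC_norm -rmorphD/= lecR; apply: supnorm_le => [|x].
  by rewrite addr_ge0// supnorm_ge0.
by rewrite (le_trans (le_normcD _ _))// lerD// normc_le_supnorm.
Qed.

Fact contC_normZ (k : R[i]) f : contC_norm (k *: f) = `|k| * contC_norm f.
Proof.
suff le l h : supnorm (l *: h) <= Normc.normc l * supnorm h.
  rewrite /contC_norm normc_normE -rmorphM/=; congr (_%:C); apply/eqP.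
  rewrite eq_le le/=.
  have [->|k0] := eqVneq k 0; first by rewrite Normc.normc0 mul0r supnorm_ge0.
  have nk0 : 0 < Normc.normc k.
    rewrite lt_neqAle normc_ge0 andbT eq_sym; apply: contra k0 => /eqP.
    by move/Normc.eq0_normc => ->.
  rewrite mulrC -ler_pdivlMr// mulrC -Normc.normcV.
  by rewrite -[in leLHS](scalerK k0 f).
apply: supnorm_le => [|x]; first by rewrite mulr_ge0 ?normc_ge0 ?supnorm_ge0.
by rewrite contC_scaleE Normc.normcM ler_wpM2l ?normc_ge0// normc_le_supnorm.
Qed.

Fact contC_norm0_eq0 f : contC_norm f = 0 -> f = 0.
Proof.
move=> /complexI f0; apply: contC_eq => x; apply: Normc.eq0_normc.
by apply/eqP; rewrite eq_le normc_ge0 andbT -f0 normc_le_supnorm.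
Qed.

HB.instance Definition _ :=
  @Lmodule_isNormed.Build _ (contC R X) contC_norm contC_normD contC_normZ contC_norm0_eq0.

Lemma contC_normE f : `|f| = (supnorm f)%:C. Proof. by []. Qed.

Lemma contC_near f x (e : R) :
  0 < e -> nbhs x [set y | Normc.normc (f x - f y) < e].
Proof.
move=> e0; apply: (@contC_continuous X f x
  [set w : R[i]^o | Normc.normc (f x - w) < e]).
apply/nbhs_ballP; exists e%:C => /=; first by rewrite ltcR.
by move=> w; rewrite -ball_normE/= normc_normE ltcR.
Qed.

Fact contC_complete (F : set_system (contC R X)) :
  ProperFilter F -> cauchy F -> cvg F.
Proof.
move=> FF /cauchy_ballP Fc.
have {}Fc (e : R) : 0 < e ->
    \forall f & g \near F, supnorm (f - g) < e.
  rewrite -ltcR => /Fc; apply: filterS => -[f g] /=.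
  by rewrite -ball_normE/= contC_normE ltcR.
have real_pos (e : R[i]) : 0 < e -> exists2 r : R, 0 < r & e = r%:C.
  by case: e => a b; rewrite ltcE/= => /andP[/eqP-> a0]; exists a.
have part (p : R[i] -> R) (pB : forall a b, p (a - b) = p a - p b)
    (pn : forall a, `|p a| <= Normc.normc a) :
    exists l : X -> R, forall x, (fun f : contC R X => p (f x)) @ F --> l x.
  suff h x : cvg ((fun f : contC R X => p (f x)) @ F).
    by exists (fun x => lim ((fun f : contC R X => p (f x)) @ F)) => x; exact: h.
  apply: R_complete; apply/cauchy_ballP => e e0.
  have := Fc e e0; case => -[P Q] /= [FP FQ] PQ.
  exists ((fun f : contC R X => p (f x)) @` P,
          (fun f : contC R X => p (f x)) @` Q) => /=.
    by split; [apply: filterS FP|apply: filterS FQ] => f hf /=; exists f.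
  move=> [_ _] /= [[f Pf <-] [g Qg <-]]; rewrite -ball_normE/= -pB.
  apply: le_lt_trans (PQ (f, g) (conj Pf Qg)).
  exact: le_trans (pn _) (normc_le_supnorm (f - g) x).
have [l1 cl1] : exists l : X -> R, forall x, (fun f : contC R X => complex.Re (f x)) @ F --> l x.
  apply: (part (@complex.Re R)) => [[? ?] [? ?]//|[a b] /=].
  by rewrite -sqrtr_sqr ler_sqrt ?addr_ge0 ?sqr_ge0// lerDl sqr_ge0.
have [l2 cl2] : exists l : X -> R, forall x, (fun f : contC R X => complex.Im (f x)) @ F --> l x.
  apply: (part (@complex.Im R)) => [[? ?] [? ?]//|[a b] /=].
  by rewrite -sqrtr_sqr ler_sqrt ?addr_ge0 ?sqr_ge0// lerDr sqr_ge0.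
pose l x : R[i]^o := l1 x +i* l2 x.
have near_l (e : R) : 0 < e ->
    F [set f : contC R X | forall x, Normc.normc (f x - l x) <= e].
  move=> e0; have e20 : 0 < e / 2 by rewrite divr_gt0.
  have [[P Q] /= [FP FQ] PQ] := Fc _ e20.
  apply: filterS FP => f Pf x.
  have e40 : 0 < e / 2 / 2 by rewrite divr_gt0.
  near F => g.
  have -> : f x - l x = (f - g) x + (g x - l x).
    by rewrite contC_subE addrA subrK.
  apply: le_trans (le_normcD _ _) _; rewrite (splitr e) lerD//.
    apply: le_trans (normc_le_supnorm _ _) _; apply: ltW.
    by apply: (PQ (f, g)); split => //=; near: g.
  have h1 : `|l1 x - complex.Re (g x)| < e / 2 / 2.
    near: g; exact: (cvgrPdist_lt _ _).1 (cl1 x) _ e40.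
  have h2 : `|l2 x - complex.Im (g x)| < e / 2 / 2.
    near: g; exact: (cvgrPdist_lt _ _).1 (cl2 x) _ e40.
  have -> : g x - l x = (complex.Re (g x) - l1 x)%:C + 'i * (complex.Im (g x) - l2 x)%:C.
    rewrite /l; case: (g x) => a b /=; apply/eqP.
    by rewrite eq_complex/=; rewrite !(mul0r, mul1r, mulr0, subr0, add0r, addr0, oppr0) !eqxx.
  apply: le_trans (le_normcD _ _) _; rewrite (splitr (e / 2)) Normc.normcM.
  have nr (r : R) : Normc.normc r%:C = `|r|.
    by rewrite /= expr0n addr0 sqrtr_sqr.
  have -> : Normc.normc ('i : R[i]) = 1.
    by rewrite /= expr0n/= add0r expr1n sqrtr1.
  by rewrite mul1r !nr lerD// distrC ltW.
have cl : continuous l.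
  move=> x A /nbhs_ballP[e /= e0 eA]; have [r r0 er] := real_pos e e0.
  have r30 : 0 < r / 3 by rewrite divr_gt0.
  have [f fl] := filter_ex (near_l _ r30).
  have H := contC_near f x r30.
  suff : nbhs x [set y | A (l y)] by [].
  apply: filterS H => y /= fxy.
  apply: (eA (l y)); rewrite -ball_normE/= normc_normE er ltcR.
  have -> : l x - l y = (f x - f y) + (- (f x - l x) + (f y - l y)).
    by rewrite opprB addrA [f x - f y + _]addrC !addrA !subrK.
  apply: le_lt_trans (le_normcD _ _) _.
  have -> : r = r / 3 + (r / 3 + r / 3) by lra.
  apply: ltr_leD => //; apply: le_trans (le_normcD _ _) _.
  by rewrite normcN lerD.
pose L := mk_contC (@cl).
apply/cvg_ex; exists L => A /nbhs_ballP[e /= e0 eA].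
have [r r0 er] := real_pos e e0.
have r20 : 0 < r / 2 by rewrite divr_gt0.
apply: filterS (near_l _ r20) => f fl; apply: eA.
rewrite -ball_normE/= contC_normE er ltcR.
apply: (@le_lt_trans _ _ (r / 2)); last by rewrite ltr_pdivrMr// ltr_pMr// ltr1n.
apply: supnorm_le => [|x]; first exact: ltW.
by rewrite contC_subE -normcN opprB; exact: fl.
Unshelve. all: by end_near. Qed.

HB.instance Definition _ := Uniform_isComplete.Build (contC R X) contC_complete.

Fact contC_mul_norm_le f g : `|f * g| <= `|f| * `|g|.
Proof.
rewrite !contC_normE -rmorphM/= lecR; apply: supnorm_le => [|x].
  by rewrite mulr_ge0 ?supnorm_ge0.
rewrite contC_mulE Normc.normcM.
by rewrite ler_pM ?normc_ge0 ?normc_le_supnorm.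
Qed.

Fact contC_scalerAl (k : R[i]) f g : k *: (f * g) = (k *: f) * g.
Proof. by apply: contC_eq => x; exact: mulrA. Qed.
Fact contC_scalerAr (k : R[i]) f g : k *: (f * g) = f * (k *: g).
Proof. by apply: contC_eq => x; exact: mulrCA. Qed.

HB.instance Definition _ := @isBanachAlgebra.Build _ (contC R X)
  *%R (@mulrA _) (@mulrDl _) (@mulrDr _) contC_scalerAl contC_scalerAr contC_mul_norm_le.

Lemma contC_bmulE f g x : bmul f g x = f x * g x. Proof. by []. Qed.

End Norm.
End ContC.

(* Main.v *)
Require Import Defs.
From mathcomp Require Import all_boot all_order all_algebra.
From mathcomp Require Import lra ring.
From mathcomp Require Import complex.
From mathcomp Require Import all_classical all_reals all_analysis.

Set Implicit Arguments.
Unset Strict Implicit.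
Unset Printing Implicit Defensive.

Import Order.TTheory GRing.Theory Num.Theory.
Import numFieldNormedType.Exports.

Local Open Scope classical_set_scope.
Local Open Scope ring_scope.
Local Open Scope complex_scope.
Local Open Scope card_scope.

(** Everything goes through one property of [X]: the functions without zeros
are dense in [C(X)] ([zero_free_dense]).

Openness gives density: the multiplication at the pair [(f, conj f)] reaches
[|f|^2 + c] for some constant [c > 0], a function without zeros, so both of its
factors, the first of which is close to [f], have no zeros
([zero_free_dense_of_open]).

Density is equivalent to [dim X <= 1]. In between stands the condition that
every open cover by three sets shrinks to one with empty triple intersection
([triples_shrink]). It is the instance for three sets of [dim X <= 1], and it
implies the rest because a finite cover can be treated one triple of indices
at a time ([shrink_no_triple]). It is also what density says: a complex number
is a triple of reals up to a common shift, the number [0] being the triples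
with equal entries, so a function without zeros is a triple of real functions
that are nowhere all equal. Such a triple shrinks a cover (retain the points
where the k-th function is not minimal), and a cover that has been shrunk tells
in which direction to push a triple away from the diagonal.

Density gives the factorization, with constants that do not involve [X]. Let
[h] be close to [f g]. Suppose first that [h] has no zeros, and let [w = h/|h|]
and [q = w conj g]. Finding [u, v] with [u v = h], near [f] and [g], amounts
to finding [r, t > 0] with [r t = |h|] and a function [y] of modulus one such
that [r y] is near [f] and [t y] is near [q]: put [u = r y] and
[v = t w conj y]. Because [f conj q] is close to the positive function [|h|],
the functions [f] and [q] point in nearly the same direction wherever they are
not small, and there it is the direction of [f + q]. So [y] can be taken to be
the phase of a function without zeros approximating [f + q]
([phase_estimate]). The moduli [r, t] are the solution of [r t = |h|] and
[r - t = |f| - |q|] ([modulus_of_near]). If [|h - f g| <= s^2], the errors are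
at most [5 s] ([factor_zero_free]).

If [h] has zeros, it is approximated by functions without zeros, which gives
[u, v] near [f, g] with [u v] arbitrarily close to [h], hence again close
enough to apply the same construction at a smaller scale; completeness of
[C(X)] makes the successive corrections converge to an exact factorization
([factor_exact]). *)

Local Notation normc := Normc.normc.

(** * Complex moduli and continuous complex functions *)

Section ComplexModulus.
Context {R : realType}.
Implicit Types z w : R[i].

Lemma sqr_normcE z : normc z ^+ 2 = complex.Re z ^+ 2 + complex.Im z ^+ 2.
Proof. by case: z => a b /=; rewrite sqr_sqrtr// addr_ge0 ?sqr_ge0. Qed.

Lemma normc_conj z : normc (conjc z) = normc z.
Proof. by case: z => a b /=; rewrite sqrrN. Qed.

Lemma conjcM z w : conjc (z * w) = conjc z * conjc w.
Proof. exact: rmorphM. Qed.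

Lemma conjcB z w : conjc (z - w) = conjc z - conjc w.
Proof. exact: rmorphB. Qed.

Lemma mul_conj_normc z : z * conjc z = (normc z ^+ 2)%:C.
Proof.
rewrite sqr_normcE; case: z => x y; apply/eqP; rewrite eq_complex /=.
by apply/andP; split; apply/eqP; ring.
Qed.

Lemma normc_real (r : R) : normc r%:C = `|r|.
Proof. by rewrite /= expr0n addr0 sqrtr_sqr. Qed.

Lemma normc_eq0 z : (normc z == 0) = (z == 0).
Proof.
by apply/eqP/eqP => [/Normc.eq0_normc //|->]; exact: Normc.normc0.
Qed.

Lemma normc_gt0 z : (0 < normc z) = (z != 0).
Proof. by rewrite lt_neqAle normc_ge0 andbT eq_sym normc_eq0. Qed.

Lemma ler_normcD z w : normc (z + w) <= normc z + normc w.
Proof. exact: le_normcD. Qed.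

Lemma normcB z w : normc (z - w) = normc (w - z).
Proof. by rewrite -normcN opprB. Qed.

Lemma ler_normcB z w : normc z - normc w <= normc (z - w).
Proof. by rewrite lerBlDr -{1}(subrK w z) ler_normcD. Qed.

Lemma normr_Re_le z : `|complex.Re z| <= normc z.
Proof.
by case: z => a b /=; rewrite -sqrtr_sqr ler_wsqrtr// lerDl sqr_ge0.
Qed.

Lemma normr_Im_le z : `|complex.Im z| <= normc z.
Proof.
by case: z => a b /=; rewrite -sqrtr_sqr ler_wsqrtr// lerDr sqr_ge0.
Qed.

Lemma normc_le_ReIm z : normc z <= `|complex.Re z| + `|complex.Im z|.
Proof.
rewrite -(ler_pXn2r (_ : (0 < 2)%N)) ?nnegrE ?normc_ge0 ?addr_ge0//.
rewrite sqr_normcE sqrrD !real_normK ?num_real//.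
by rewrite lerD2r lerDl mulrn_wge0// mulr_ge0.
Qed.

End ComplexModulus.

Section ContinuousParts.
Context {R : realType} {X : topologicalType}.
Implicit Types f g : contC R X.

Lemma continuous_to_R (a : X -> R) :
  (forall x e, 0 < e -> \forall y \near x, `|a x - a y| < e) -> continuous a.
Proof. by move=> ca x; apply/cvgrPdist_lt => e; exact: ca. Qed.

Lemma continuous_sumR (a b : X -> R) : continuous a -> continuous b ->
  continuous (fun x => a x + b x).
Proof.
by move=> ca cb x; apply: (@continuousD _ R^o X a); [exact: ca|exact: cb].
Qed.

Lemma continuous_diffR (a b : X -> R) : continuous a -> continuous b ->
  continuous (fun x => a x - b x).
Proof.
by move=> ca cb x; apply: (@continuousB _ R^o X a); [exact: ca|exact: cb].
Qed.

Lemma continuous_prodR (a b : X -> R) : continuous a -> continuous b ->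
  continuous (fun x => a x * b x).
Proof.
by move=> ca cb x; apply: (@continuousM R X a); [exact: ca|exact: cb].
Qed.

Lemma open_gt0 (a : X -> R) : continuous a -> open [set x | 0 < a x].
Proof.
by move=> ca; apply: (@open_comp _ _ a [set y | y > 0]) => [x _|];
  [exact: ca|exact: open_gt].
Qed.


Lemma continuous_of_normc_le f (p : R[i] -> R) :
  (forall z w, `|p z - p w| <= normc (z - w)) -> continuous (p \o f).
Proof.
move=> pL; apply: continuous_to_R => x e e0.
have : \forall y \near x, normc (f x - f y) < e.
  have := @contC_continuous _ _ f x
    [set w : R[i]^o | normc (f x - w) < e].
  apply; apply/nbhs_ballP; exists e%:C => /=; first by rewrite ltcR.
  by move=> w; rewrite -ball_normE/= normc_normE ltcR.
by apply: filterS => y; exact: le_lt_trans (pL _ _).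
Qed.

Lemma continuous_normc f : continuous (fun x => normc (f x)).
Proof.
apply: (@continuous_of_normc_le f (fun z => normc z)) => z w.
by rewrite ler_norml ler_normcB andbT lerNl opprB normcB ler_normcB.
Qed.

Lemma continuous_Re f : continuous (fun x => complex.Re (f x)).
Proof.
apply: (@continuous_of_normc_le f (fun z => complex.Re z)) => z w.
by have := normr_Re_le (z - w); case: z w => [? ?] [? ?].
Qed.

Lemma continuous_Im f : continuous (fun x => complex.Im (f x)).
Proof.
apply: (@continuous_of_normc_le f (fun z => complex.Im z)) => z w.
by have := normr_Im_le (z - w); case: z w => [? ?] [? ?].
Qed.

Lemma continuous_pair (a b : X -> R) : continuous a -> continuous b ->
  continuous (fun x => a x +i* b x : R[i]^o).
Proof.
move=> ca cb x A /nbhs_ballP[[e e'] /=]; rewrite ltcE => /andP[/eqP/= -> e0] eA.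
have e20 : 0 < e / 2 by rewrite divr_gt0.
have H : \forall y \near x, `|a x - a y| < e / 2.
  exact: (cvgrPdist_lt _ _).1 (ca x) _ e20.
have K : \forall y \near x, `|b x - b y| < e / 2.
  exact: (cvgrPdist_lt _ _).1 (cb x) _ e20.
suff : \forall y \near x, A (a y +i* b y) by [].
near=> y; apply: eA; rewrite -ball_normE/= normc_normE ltcR.
rewrite (le_lt_trans (normc_le_ReIm _))//= (splitr e) ltrD//; near: y.
  exact: H.
exact: K.
Unshelve. all: by end_near. Qed.

Definition contC_pair (a b : X -> R)
    (ca : continuous a) (cb : continuous b) : contC R X :=
  mk_contC (@continuous_pair a b ca cb).

Definition contC_real (a : X -> R) (ca : continuous a) : contC R X :=
  contC_pair ca (@cst_continuous X R 0).

Lemma contC_realE (a : X -> R) (ca : continuous a) x : contC_real ca x = (a x)%:C.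
Proof. by []. Qed.

Lemma continuous_conj f : continuous (fun x => conjc (f x) : R[i]^o).
Proof.
have -> : (fun x => conjc (f x)) =
    fun x => complex.Re (f x) -i* complex.Im (f x).
  by apply/funext => x; case: (f x).
apply: continuous_pair; first exact: continuous_Re.
by move=> x; apply: (@continuousN _ R^o X (fun y => complex.Im (f y)));
  exact: continuous_Im.
Qed.

Definition contC_conj f : contC R X := mk_contC (@continuous_conj f).

Lemma contC_conjE f x : contC_conj f x = conjc (f x). Proof. by []. Qed.

End ContinuousParts.

(** * Bump functions and covers of dimension at most one *)

Section Bumps.
Context {R : realType} {X : compactHausdorffType}.

(** The closed set outside [W] lies in [U], and Urysohn's lemma separates it from
the complement of [U]. The level 1/2 leaves an open set that can replace [U] in
a cover. *)
Lemma urysohn_shrink (U W : set X) : open U -> open W ->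
    (forall x, U x \/ W x) ->
  exists f : X -> R, [/\ continuous f, forall x, 0 <= f x <= 1,
    forall x, 0 < f x -> U x & forall x, f x > 2^-1 \/ W x].
Proof.
move=> oU oW UW.
have nX := compact_normal (@space_hausdorff X) (@space_compact X).
have UW0 : ~` U `&` ~` W = set0.
  by apply/seteqP; split => // x [nU nW]; case: (UW x).
have := (@normal_separatorP R _).1 nX _ _ (open_closedC oU) (open_closedC oW) UW0.
move=> /(@uniform_separatorP _ R)[f [cf f01 f0 f1]].
have bf x : 0 <= f x <= 1.
  by have := f01 (f x) (ex_intro2 _ _ x I erefl); rewrite /= in_itv.
exists f; split => // x.
  move=> fx0; apply: contrapT => nU.
  by have := f0 (f x) (ex_intro2 _ _ x nU erefl) => /= E; rewrite E ltxx in fx0.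
have [Wx|nW] := pselect (W x); [by right|left].
have := f1 (f x) (ex_intro2 _ _ x nW erefl) => /= ->.
by rewrite invf_lt1// ltr1n.
Qed.

(** This replaces a partition of unity: the functions are not normalized, but one
of them exceeds 1/2 at each point. *)
Lemma open_cover_bumps (I : finType) (U : I -> set X) :
    (forall i, open (U i)) -> (forall x, exists i, U i x) ->
  exists f : I -> X -> R, [/\ forall i, continuous (f i),
    forall i x, 0 <= f i x <= 1, forall i x, 0 < f i x -> U i x &
    forall x, exists i, f i x > 2^-1].
Proof.
move=> oU cU.
(* The sets are replaced one at a time by the superlevel sets of their bumps;
   along the way the replaced and the remaining ones still cover. *)
suff [f [cf bf Uf hf]] : exists f : I -> X -> R, [/\ forall i, continuous (f i),
    forall i x, 0 <= f i x <= 1, forall i x, 0 < f i x -> U i x &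
    forall x, exists i, (if i \in enum I then [set y | f i y > 2^-1] else U i) x].
  exists f; split => // x.
  by have [k] := hf x; rewrite mem_enum => ?; exists k.
elim: (enum I) => [|j s [f [cf bf Uf hf]]].
  exists (fun _ => cst 0); split => [i|i x|i x|x].
  - exact: cst_continuous.
  - by rewrite lexx ler01.
  - by rewrite ltxx.
  - by have [k] := cU x; exists k.
pose P i : set X := if i \in s then [set x | f i x > 2^-1] else U i.
have oP i : open (P i).
  rewrite /P; case: ifP => // _.
  by apply: (@open_comp _ _ (f i) [set y | y > 2^-1]) => [x _|];
    [exact: cf|exact: open_gt].
have [|x|g [cg bg Ug hg]] := @urysohn_shrink (U j)
    (\bigcup_(i in [set i | i != j]) P i) (oU j).
- by apply: bigcup_open => i _.
- have [i +] := hf x; have [->|ij] := eqVneq i j.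
    by case: ifP => _ hx; left => //; apply: (Uf j); apply: lt_trans hx.
  by move=> hx; right; exists i => //; rewrite /P; case: ifP hx.
exists (fun i => if i == j then g else f i); split => [i|i x|i x|x].
- by case: ifP.
- by case: ifP.
- by case: eqP => [->|_]; [exact: Ug|exact: Uf].
- have [gx|[i /= ij Pi]] := hg x.
    by exists j; rewrite inE eqxx.
  exists i; rewrite inE (negbTE ij)/=.
  by move: Pi; rewrite /P; case: ifP.
Qed.

End Bumps.

Section CoveringDimension.
Context {X : topologicalType}.

(** The case of three sets of [dim X <= 1], to which the dimension is reduced. *)
Definition triples_shrink :=
  forall U : 'I_3 -> set X,
    (forall k, open (U k)) -> (forall x, exists k, U k x) ->
  exists V : 'I_3 -> set X, [/\ forall k, open (V k), forall k, V k `<=` U k,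
    forall x, exists k, V k x & forall x, exists k, ~ V k x].

(** The members of a refinement are grouped by the set of the cover in which they
are contained; a point in all three groups would lie in three distinct
members. *)
Lemma triples_shrink_of_dim : covering_dim_le 1 X -> triples_shrink.
Proof.
move=> dX U oU cU.
have [||V [_ [oV cV] rV dV]] := dX (range U).
- by apply: finite_image; exact: finite_finset.
- split; first by move=> _ [k _ <-].
  apply/seteqP; split => // x _; have [k Ux] := cU x.
  by exists (U k) => //; exists k.
have /choice[g gV] (B : set X) : exists k, V B -> B `<=` U k.
  have [/rV[_ [k _ <-] BU]|nV] := pselect (V B); first by exists k.
  by exists ord0.
exists (fun k => \bigcup_(B in [set B | V B /\ g B = k]) B); split.
- by move=> k; apply: bigcup_open => B [/oV].
- by move=> k x [B [VB <-]]; exact: gV.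
- move=> x; have : [set: X] x by [].
  by rewrite -cV => -[B VB Bx]; exists (g B), B.
move=> x; apply: contrapT => /forallNP Vx.
have : `I_3 #<= `I_2.
  apply: card_le_trans (dV x).
  apply: card_le_trans (card_image_le (fun B => g B : nat) _).
  apply: subset_card_le => k /= k3.
  have /contrapT[B [VB gB] Bx] := Vx (Ordinal k3).
  by exists B => //; rewrite gB.
by rewrite card_le_II.
Qed.

(** Triples of indices are treated one after the other. For distinct [i], [j],
[k], the hypothesis is applied to [W i], [W j] and the union of all the other
sets; intersecting with the shrunk sets separates this triple, and
it destroys nothing achieved before since the sets only get smaller. *)
Lemma shrink_no_triple (I : finType) (U : I -> set X) : triples_shrink ->
    (forall i, open (U i)) -> (forall x, exists i, U i x) ->
  exists W : I -> set X, [/\ forall i, open (W i), forall i, W i `<=` U i,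
    forall x, exists i, W i x & forall i j k x, W i x -> W j x -> W k x ->
      [|| i == j, j == k | k == i]].
Proof.
move=> tX oU cU.
suff [W [oW WU cW hW]] : exists W : I -> set X, [/\ forall i, open (W i),
    forall i, W i `<=` U i, forall x, exists i, W i x &
    forall i j k x, (i, j, k) \in enum {: I * I * I} ->
      W i x -> W j x -> W k x -> [|| i == j, j == k | k == i]].
  by exists W; split => // i j k x; apply: hW; rewrite mem_enum.
elim: (enum _) => [|[[i j] k] s [W [oW WU cW hW]]].
  by exists U; split => // i; exact: subset_refl.
have [ijk|] := boolP [|| i == j, j == k | k == i].
  exists W; split => // i' j' k' x; rewrite inE => /orP[/eqP[-> -> ->]//|].
  exact: hW.
rewrite !negb_or => /and3P[ij jk ki].
pose T (l : I) : 'I_3 :=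
  if l == i then ord0 else if l == j then lift ord0 ord0 else ord_max.
have [||V [oV VT cV tV]] :=
  tX (fun t : 'I_3 => \bigcup_(l in [set l | T l = t]) W l).
- by move=> t; apply: bigcup_open => l _.
- by move=> x; have [l Wl] := cW x; exists (T l), l.
exists (fun l => W l `&` V (T l)); split => [l|l x [/WU]//|x|].
- exact: openI.
- have [t Vx] := cV x; have [l /= lt Wx] := VT _ _ Vx.
  by exists l; split; rewrite ?lt.
move=> i' j' k' x; rewrite inE => /orP[/eqP[-> -> ->]|ss] [Wi Vi] [Wj Vj] [Wk Vk].
  exfalso; have [t] := tV x; apply.
  move: Vi Vj Vk; rewrite /T eqxx eq_sym (negbTE ij) eqxx (negbTE ki).
  rewrite eq_sym (negbTE jk).
  by case: t => -[|[|[|//]]] p; [move=> + _ _|move=> _ + _|move=> _ _];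
    congr (V _ x); exact/val_inj.
exact: (hW i' j' k' x).
Qed.

Lemma dim_of_triples_shrink : triples_shrink -> covering_dim_le 1 X.
Proof.
move=> tX U /finite_seqP[s ->] [oU cU].
pose A (i : 'I_(size s)) := nth set0 s i.
have sA i : A i \in s by exact: mem_nth.
have [||W [oW WA cW hW]] := @shrink_no_triple _ A tX.
- by move=> i; apply: oU; exact: sA.
- move=> x; have : [set: X] x by [].
  rewrite -cU => -[B /= Bs Bx].
  have Bi : (index B s < size s)%N by rewrite index_mem.
  by exists (Ordinal Bi); rewrite /A nth_index.
exists (range W); split.
- by apply: finite_image; exact: finite_finset.
- split=> [_ [i _ <-]//|]; apply/seteqP; split => // x _.
  by have [i Wx] := cW x; exists (W i) => //; exists i.
- by move=> _ [i _ <-]; exists (A i) => //; exact: sA.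
move=> x; have [i0 _] := cW x.
pose T := [set i | `[< W i x >]]%SET.
have T2 : (#|T| <= 2)%N.
  rewrite leqNgt; apply/negP => /card_gt2P[i [j [k [[+ + +] [ij jk ki]]]]].
  rewrite !finset.in_set => /asboolP Wi /asboolP Wj /asboolP Wk.
  by have := hW _ _ _ _ Wi Wj Wk; rewrite (negbTE ij) (negbTE jk) (negbTE ki).
apply: card_le_trans (card_image_le (fun n => W (nth i0 (enum T) n)) _).
apply: subset_card_le => _ [[i _ <-] Wx].
have iT : i \in enum T by rewrite mem_enum finset.in_set; exact/asboolP.
exists (index i (enum T)); last by rewrite nth_index.
by rewrite /= (leq_trans _ T2)// cardE index_mem.
Qed.

End CoveringDimension.

(** * Functions without zeros *)

(** The functions without zeros are the invertible elements of [C(X)], so this is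
the density of the invertible elements. *)
Definition zero_free_dense (R : realType) (X : topologicalType) :=
  forall (f : contC R X) (e : R), 0 < e ->
  exists2 g : contC R X, forall x, g x != 0 & forall x, normc (f x - g x) <= e.

Lemma ord3_ind (P : 'I_3 -> Prop) :
  P ord0 -> P (lift ord0 ord0) -> P ord_max -> forall k, P k.
Proof.
move=> P0 P1 P2 [[|[|[|//]]] p].
- by rewrite (_ : Ordinal p = ord0)//; exact/val_inj.
- by rewrite (_ : Ordinal p = lift ord0 ord0)//; exact/val_inj.
- by rewrite (_ : Ordinal p = ord_max)//; exact/val_inj.
Qed.

Definition three T (a b c : T) (k : 'I_3) : T :=
  match val k with 0 => a | 1 => b | _ => c end%N.

Lemma argmax3 (R : realType) (a : 'I_3 -> R) : exists k, forall j, a j <= a k.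
Proof.
by case: (Order.TotalTheory.arg_maxP a (P := xpredT) (i0 := ord0)) => // k _ h;
  exists k => j; exact: h.
Qed.

Section ZeroFree.
Context {R : realType} {X : compactHausdorffType}.

(** Write [f] as the triple [l] of real functions [Re f], [Im f] and
[- Re f - Im f], of sum zero, so that [f] vanishes where all three do. The sets
where [l k > - n] cover [X]. Let [m] be bumps for a shrinking of this cover, one
of which therefore vanishes at each point. Adding to [l] a large enough multiple
of [n] times the centred triple [m - mu] removes all zeros: where [m k] is the
largest bump, [l k > - n], and the push in the [k]-th coordinate exceeds [n]. *)
Lemma zero_free_dense_of_triples : @triples_shrink X -> zero_free_dense R X.
Proof.
move=> tX f e e0.
have [n n0 ne] : exists2 n, 0 < n & n * 12 = e by exists (e / 12); lra.
pose l := three (fun x => complex.Re (f x)) (fun x => complex.Im (f x))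
  (fun x => - complex.Re (f x) - complex.Im (f x)).
have cl k : continuous (l k).
  move: k; apply: ord3_ind => /=; [exact: continuous_Re|exact: continuous_Im|].
  apply: continuous_diffR; last exact: continuous_Im.
  move=> x; apply: (@continuousN _ R^o X (fun y => complex.Re (f y))).
  exact: continuous_Re.
have [||V [oV VU cV tV]] := tX (fun k => [set x | 0 < l k x + n]).
- move=> k; apply: open_gt0.
  by apply: continuous_sumR; [exact: cl|exact: cst_continuous].
- move=> x; apply: contrapT => /forallNP h.
  have := h ord0; have := h (lift ord0 ord0); have := h ord_max.
  by rewrite /l/three/= => /negP + /negP + /negP; rewrite -!leNgt; lra.
have [m [cm bm mV hm]] := @open_cover_bumps R X _ V oV cV.
pose mu x := (m ord0 x + m (lift ord0 ord0) x + m ord_max x) / 3.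
have cd k : continuous (fun x => 6 * n * (m k x - mu x)).
  apply: continuous_prodR; first exact: cst_continuous.
  apply: continuous_diffR; first exact: cm.
  apply: continuous_prodR; last exact: cst_continuous.
  by apply: continuous_sumR; [apply: continuous_sumR|]; exact: cm.
pose c : contC R X := contC_pair (cd ord0) (cd (lift ord0 ord0)).
exists (f + c) => x; last first.
  rewrite contC_addE opprD addrA subrr add0r normcN.
  apply: le_trans (normc_le_ReIm _) _; rewrite /c /=.
  have b0 := bm ord0 x; have b1 := bm (lift ord0 ord0) x; have b2 := bm ord_max x.
  have h : `|m ord0 x - mu x| <= 1 by rewrite ler_norml /mu; lra.
  have h' : `|m (lift ord0 ord0) x - mu x| <= 1 by rewrite ler_norml /mu; lra.
  rewrite !normrM; have -> : `|6 : R| = 6 by rewrite ger0_norm.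
  rewrite (gtr0_norm n0).
  by nra.
apply/negP => /eqP fx0.
have lE : forall k, l k x = - (6 * n * (m k x - mu x)).
  have := congr1 (@complex.Re R) fx0; have := congr1 (@complex.Im R) fx0.
  rewrite contC_addE /c; case E : (f x) => [u v] /= hv hu.
  apply: ord3_ind; rewrite /l/three/= E /=; [lra|lra|].
  by move: hu hv; rewrite /mu; lra.
have [k hk] := argmax3 (fun k => m k x).
have [i hi] := hm x; have := hk i => /= ik.
have mk0 : 0 < m k x by apply: lt_le_trans ik; apply: lt_trans hi; lra.
have := VU _ _ (mV _ _ mk0); rewrite /= lE.
have [t nVt] := tV x.
have mt0 : m t x = 0.
  apply/eqP; have /andP[t0 _] := bm t x; rewrite eq_le t0 andbT leNgt.
  by apply/negP => /mV.
(* Only two of the three bumps contribute to the mean, so the largest one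
   exceeds the mean by at least a third of its value, hence by more than 1/6;
   this is where the factor 6 comes from. *)
have mu2 : 3 * mu x <= 2 * m k x.
  rewrite /mu; have := hk ord0; have := hk (lift ord0 ord0); have := hk ord_max.
  by move=> /=; move: t mt0 {nVt}; apply: ord3_ind => ->; lra.
have : 1 / 2 < m k x by lra.
by nra.
Qed.

(** Let [l] be bumps for the cover, encoded as the complex function [f] with parts
[l 0 - l 2] and [l 1 - l 2]. A nearby function without zeros decodes to a
triple [a] close to [l] whose entries are nowhere all equal. The points where
[a k] is not the least entry form three sets that cover [X] and have no common
point. Intersecting with [l k > 0] places them inside the given sets, and it
still leaves a cover: the largest entry is away from zero. *)
Lemma triples_of_zero_free_dense : zero_free_dense R X -> @triples_shrink X.
Proof.
move=> dX U oU cU.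
have [l [cl bl lU hl]] := @open_cover_bumps R X _ U oU cU.
pose f : contC R X := contC_pair (continuous_diffR (cl ord0) (cl ord_max))
  (continuous_diffR (cl (lift ord0 ord0)) (cl ord_max)).
have [|g g0 fg] := dX f 8^-1; first by lra.
pose a := three (fun x => l ord_max x + complex.Re (g x))
  (fun x => l ord_max x + complex.Im (g x)) (l ord_max).
have ca k : continuous (a k).
  move: k; apply: ord3_ind; rewrite /a/three/=.
  - by apply: continuous_sumR; [exact: cl|exact: continuous_Re].
  - by apply: continuous_sumR; [exact: cl|exact: continuous_Im].
  - exact: cl.
have al : forall k x, `|a k x - l k x| <= 8^-1.
  move=> k x; have h1 := le_trans (normr_Re_le (f x - g x)) (fg x).
  have h2 := le_trans (normr_Im_le (f x - g x)) (fg x).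
  move: h1 h2; rewrite /f; case E : (g x) => [u v] /= h2 h1; move: k.
  apply: ord3_ind; rewrite /a/three/= ?E/=.
  - by move: h2; rewrite !ler_norml; lra.
  - by move: h1; rewrite !ler_norml; lra.
  - by rewrite subrr normr0; lra.
exists (fun k => [set x | 0 < l k x] `&`
                 \bigcup_j [set x | 0 < a k x - a j x]); split.
- move=> k; apply: openI; first exact: open_gt0.
  by apply: bigcup_open => j _; exact: open_gt0 (continuous_diffR (ca k) (ca j)).
- by move=> k x [/= /lU].
- move=> x; have [k hk] := argmax3 (fun k => a k x); exists k; split => /=.
    have [i hi] := hl x; have := hk i; have := al i x; have := al k x.
    by rewrite !ler_norml; lra.
  apply: contrapT => nh.
  have h j : a j x = a k x.
    apply/eqP; rewrite eq_le hk/= leNgt; apply/negP => jk.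
    by apply: nh; exists j => //=; rewrite subr_gt0.
  have := g0 x; rewrite eq_complex /= => /negP; apply.
  have := h ord0; have := h (lift ord0 ord0); have := h ord_max.
  by rewrite /a/three/= => <- h1 h2; apply/andP; split; apply/eqP; lra.
move=> x; have [k hk] := argmax3 (fun k => - a k x); exists k.
by move=> [_ [j _ /=]]; have := hk j; lra.
Qed.

Lemma contC_ballE (f g : contC R X) (e : R) :
  ball f e%:C g = (supnorm (f - g) < e) :> Prop.
Proof. by rewrite -ball_normE/= contC_normE ltcR. Qed.

Lemma complex_gt0 (e : R[i]) : 0 < e -> exists2 r : R, 0 < r & e = r%:C.
Proof. by case: e => a b; rewrite ltcE/= => /andP[/eqP-> a0]; exists a. Qed.

(** A factorization of [|f|^2 + r / 2] near [(f, conj f)] has a first factor near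
[f], which has no zeros because the product has none. *)
Lemma zero_free_dense_of_open : open_multiplication (contC R X) ->
  zero_free_dense R X.
Proof.
move=> oX f e e0.
pose p : contC R X * contC R X := (f, contC_conj f).
have e0' : 0 < e%:C by rewrite ltcR.
have := oX ((ball p e%:C)°) (@open_interior _ _).
rewrite openE => /(_ (mulmap p)) H.
have /H/nbhs_ballP[d /= /complex_gt0[r r0 ->] sub] :
    (@mulmap _ (contC R X) @` (ball p e%:C)°) (mulmap p).
  by exists p => //; exact: nbhsx_ballx.
have cr : continuous (fun _ : X => r / 2) by exact: cst_continuous.
have [|[g h] /interior_subset[/= fg _] gh] := sub (mulmap p + contC_real cr).
  rewrite -ball_normE /= opprD addrA subrr add0r normrN contC_normE ltcR.
  apply: (@le_lt_trans _ _ (r / 2)); last by lra.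
  apply: supnorm_le => [|x]; first by lra.
  by rewrite contC_realE normc_real ger0_norm; lra.
exists g => x; last first.
  apply: le_trans (normc_le_supnorm (f - g) x) _; apply: ltW.
  by rewrite -contC_ballE.
move: gh; rewrite /mulmap /= => gh.
apply/negP => /eqP gx0.
have : (g * h) x = (f * contC_conj f) x + (r / 2)%:C 
  by move: (congr1 (fun k : contC R X => k x) gh).
rewrite contC_mulE gx0 mul0r contC_mulE contC_conjE.
move=> /esym/(congr1 (@complex.Re R)).
by case: (f x) => u v /=; nra.
Qed.

End ZeroFree.

(** * Simultaneous approximation by multiples of one direction *)

Section Pointwise.
Context {R : realType}.
Implicit Types p q F : R[i].

Lemma sqr_normc_scaleB p F (t : R) :
  normc (t%:C * F - p) ^+ 2 =
  t ^+ 2 * normc F ^+ 2 - 2 * t * complex.Re (p * conjc F) + normc p ^+ 2.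
Proof.
by rewrite !sqr_normcE; case: p F => [a b] [c d] /=; ring.
Qed.

(** The point [p] is near the multiple of [F] of modulus [|p|]. Where
[|p| < 2 s] this is trivial. Elsewhere the squared distance is
[2 |p| (|p| |F| - Re (p conj F)) / |F|]. The bracket is at most [4 s^2], since
[|p| |q|] and [Re (p conj q)] are both within [s^2] of [H] and replacing [F] by
[p + q] costs at most [2 |p| n]; and [|p| <= 2 |F|], since [p] and [q] cannot cancel:
[|p + q|^2 >= |p|^2 - 2 s^2]. *)
Lemma phase_estimate p q F (H s n : R) : 0 < s -> 0 <= n -> 0 <= H ->
    normc (p * conjc q - H%:C) <= s ^+ 2 -> normc (p + q - F) <= n ->
    normc p * n <= s ^+ 2 -> 10 * n <= s -> F != 0 ->
  normc ((normc p / normc F)%:C * F - p) <= 4 * s.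
Proof.
move=> s0 n0 H0 pqH pqF pn ns F0.
have N0 : 0 < normc F by rewrite normc_gt0.
have P0 := normc_ge0 p; have Q0 := normc_ge0 q.
have PQ : normc p * normc q <= H + s ^+ 2.
  have := ler_normcB (p * conjc q) H%:C.
  by rewrite Normc.normcM normc_conj normc_real ger0_norm//; lra.
have RePQ : H - s ^+ 2 <= complex.Re (p * conjc q).
  have := le_trans (normr_Re_le _) pqH; rewrite ler_norml.
  by case: p q {pqH pqF pn P0 Q0 PQ} => [a b] [c d] /=; lra.
have NPQ : normc F <= normc p + normc q + n.
  have := ler_normcB F (p + q); rewrite normcB => h.
  by have := ler_normcD p q; lra.
have RePF : normc p ^+ 2 + complex.Re (p * conjc q) - normc p * n <=
    complex.Re (p * conjc F).
  have : complex.Re (p * (conjc (p + q - F))) <= normc p * n.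
    apply: le_trans (ler_norm _) _; apply: le_trans (normr_Re_le _) _.
    by rewrite Normc.normcM normc_conj ler_wpM2l.
  rewrite sqr_normcE.
  case: p q F {N0 P0 Q0 PQ RePQ NPQ pqH pqF pn F0} => [a b] [c d] [u v] /=; lra.
have [Ps|sP] := ltP (normc p) (2 * s).
  apply: le_trans (ler_normcD _ _) _; rewrite normcN Normc.normcM normc_real.
  by rewrite ger0_norm ?divr_ge0 ?normc_ge0// divfK ?gt_eqF//; lra.
have S2 : normc (p + q) ^+ 2 =
    normc p ^+ 2 + normc q ^+ 2 + 2 * complex.Re (p * conjc q).
  rewrite !sqr_normcE.
  by case: p q {pqH pqF pn P0 Q0 PQ RePQ NPQ RePF sP} => [a b] [c d] /=; ring.
have PS : normc p * (7 / 10) <= normc (p + q).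
  have h7 : (0 : R) <= 7 / 10 by lra.
  rewrite -(ler_pXn2r (_ : (0 < 2)%N)) ?nnegrE ?normc_ge0 ?mulr_ge0//.
  by rewrite S2; nra.
have PN : normc p <= 2 * normc F.
  by have := ler_normcB (p + q) F; lra.
have gap : normc p * normc F - complex.Re (p * conjc F) <= 4 * s ^+ 2 by nra.
rewrite -(ler_pXn2r (_ : (0 < 2)%N)) ?nnegrE ?normc_ge0 ?mulr_ge0 ?(ltW s0)//.
rewrite sqr_normc_scaleB.
have -> : (normc p / normc F) ^+ 2 * normc F ^+ 2 -
    2 * (normc p / normc F) * complex.Re (p * conjc F) + normc p ^+ 2 =
    (normc p / normc F) *
      (2 * (normc p * normc F - complex.Re (p * conjc F))).
  by field; rewrite gt_eqF.
have r0 : 0 <= normc p / normc F by rewrite divr_ge0// normc_ge0.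
have r2 : normc p / normc F <= 2 by rewrite ler_pdivrMr.
set t := normc p / normc F in r0 r2 *.
set G := normc p * normc F - _ in gap *.
apply: (@le_trans _ _ (t * (8 * s ^+ 2))).
  by rewrite ler_wpM2l//; lra.
by have : 0 < s ^+ 2 by [rewrite exprn_gt0]; nra.
Qed.

(** The solution [r] of [r t = H], [r - t = P - Q] with [r, t > 0]; exchanging [P]
and [Q] gives [t]. *)
Definition modulus_of (P Q H : R) : R :=
  (P - Q + Num.sqrt ((P - Q) ^+ 2 + 4 * H)) / 2.

Lemma modulus_ofE (P Q H : R) : 0 < H ->
  exists t : R, [/\ 0 <= t, t ^+ 2 = (P - Q) ^+ 2 + 4 * H,
  modulus_of P Q H = (P - Q + t) / 2 & modulus_of Q P H = (Q - P + t) / 2].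
Proof.
move=> H0; exists (Num.sqrt ((P - Q) ^+ 2 + 4 * H)); split => //.
- by rewrite sqr_sqrtr// addr_ge0 ?sqr_ge0 ?mulr_ge0 ?(ltW H0).
- by rewrite /modulus_of -[Q - P]opprB sqrrN.
Qed.

Lemma modulus_of_mul (P Q H : R) : 0 < H ->
  modulus_of P Q H * modulus_of Q P H = H.
Proof. by move=> H0; have [t [_ t2 -> ->]] := modulus_ofE P Q H0; lra. Qed.

(** With [r - t = P - Q], the error on [P] is half the error on the sum:
[(r + t)^2 - (P + Q)^2 = 4 (H - P Q)], so [r + t] is within [2 s] of
[P + Q]. *)
Lemma modulus_of_near (P Q H s : R) : 0 <= P -> 0 <= Q -> 0 < H -> 0 < s ->
  `|P * Q - H| <= s ^+ 2 -> `|modulus_of P Q H - P| <= s.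
Proof.
move=> P0 Q0 H0 s0; have [t [t0 t2 -> _]] := modulus_ofE P Q H0.
rewrite !ler_norml => /andP[h1 h2].
have sP := mulr_ge0 (ltW s0) P0; have sQ := mulr_ge0 (ltW s0) Q0.
have st := mulr_ge0 (ltW s0) t0.
have le_of_sqr (x y : R) : 0 <= x -> 0 <= y -> x ^+ 2 <= y ^+ 2 -> x <= y.
  by move=> x0 y0; rewrite ler_pXn2r ?nnegrE.
have k1 : t <= P + Q + 2 * s by apply: le_of_sqr => //; lra.
have k2 : P + Q <= t + 2 * s by apply: le_of_sqr => //; lra.
by apply/andP; split; lra.
Qed.

(** The construction at one point: [a], [b] are the values of the given factors,
[c] that of the function to be factored and [F] that of the function providing
the common direction. *)
Section Factor.
Variables (a b c F : R[i]) (s n : R).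
Hypotheses (s0 : 0 < s) (n0 : 0 <= n) (ns : 10 * n <= s).
Hypotheses (an : normc a * n <= s ^+ 2) (bn : normc b * n <= s ^+ 2).
Hypotheses (abc : normc (c - a * b) <= s ^+ 2) (c0 : c != 0) (F0 : F != 0).

Let w := (normc c)^-1%:C * c.
Hypothesis abF : normc (a + w * conjc b - F) <= n.

Let u := (modulus_of (normc a) (normc b) (normc c) / normc F)%:C * F.
Let v := (modulus_of (normc b) (normc a) (normc c) / normc F)%:C * (w * conjc F).

Lemma normc_phase : normc w = 1.
Proof.
rewrite Normc.normcM normc_real ger0_norm ?invr_ge0 ?normc_ge0//.
by rewrite mulVf// normc_eq0.
Qed.

Lemma factor_mul : u * v = c.
Proof.
rewrite /u /v mulrACA -rmorphM/= [F * _]mulrCA mul_conj_normc mulrCA -rmorphM /=.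
rewrite mulf_div modulus_of_mul ?normc_ge0 ?normc_gt0// -expr2 divfK; last first.
  by rewrite expf_eq0/= normc_eq0.
by rewrite /w mulrAC -rmorphM mulVf ?normc_eq0// mul1r.
Qed.

(** This is the hypothesis of [phase_estimate] for the pair [a], [w conj b]: after
multiplication by the conjugate phase of [c], the number [c] becomes its
modulus. *)
Lemma factor_product_near :
  normc (a * conjc (w * conjc b) - (normc c)%:C) <= s ^+ 2.
Proof.
have wc : conjc w * c = (normc c)%:C.
  rewrite /w conjcM conjc_real -mulrA [conjc c * c]mulrC mul_conj_normc.
  by rewrite -rmorphM/= expr2 mulrA mulVf ?normc_eq0// mul1r.
have -> : a * conjc (w * conjc b) - (normc c)%:C = conjc w * (a * b - c).
  by rewrite conjcM conjcK -wc; ring.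
by rewrite Normc.normcM normc_conj normc_phase mul1r normcB.
Qed.

Lemma normc_twist : normc (w * conjc b) = normc b.
Proof. by rewrite Normc.normcM normc_phase mul1r normc_conj. Qed.

Lemma moduli_near : `|normc a * normc b - normc c| <= s ^+ 2.
Proof.
rewrite -Normc.normcM; apply: le_trans abc; rewrite ler_norml.
by rewrite [X in _ && (_ <= X)]normcB ler_normcB andbT lerNl opprB ler_normcB.
Qed.

Lemma rescale_near p (P r : R) : normc ((P / normc F)%:C * F - p) <= 4 * s ->
  `|r - P| <= s -> normc ((r / normc F)%:C * F - p) <= 5 * s.
Proof.
move=> hP rP.
have -> : (r / normc F)%:C * F - p =
    ((r - P) / normc F)%:C * F + ((P / normc F)%:C * F - p).
  by rewrite mulrBl rmorphB/=; ring.
apply: le_trans (ler_normcD _ _) _; rewrite Normc.normcM normc_real normrM.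
rewrite [`|(normc F)^-1|]ger0_norm ?invr_ge0 ?normc_ge0// divfK ?normc_eq0//.
lra.
Qed.

Lemma factor_near_l : normc (a - u) <= 5 * s.
Proof.
rewrite normcB; apply: rescale_near; last first.
  by apply: modulus_of_near; rewrite ?normc_ge0 ?normc_gt0//; exact: moduli_near.
apply: (@phase_estimate _ (w * conjc b) _ (normc c) s n) => //.
  exact: normc_ge0.
exact: factor_product_near.
Qed.

(** The map taking [z] to [w conj z] is an isometry; it takes [v] to a positive
multiple of [F], so the estimate applies with the roles of [a] and [w conj b]
exchanged. *)
Lemma factor_near_r : normc (b - v) <= 5 * s.
Proof.
have -> : normc (b - v) = normc (
    (modulus_of (normc b) (normc a) (normc c) / normc F)%:C * F - w * conjc b).
  rewrite normcB -[LHS]mul1r -normc_phase -(normc_conj (v - b)) -Normc.normcM.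
  congr normc; rewrite conjcB mulrBr; congr (_ - _).
  rewrite /v 2!conjcM conjcK mulrCA [w * _]mulrA mul_conj_normc normc_phase.
  by rewrite expr1n mul1r conjc_real.
apply: rescale_near; last first.
  apply: modulus_of_near; rewrite ?normc_ge0 ?normc_gt0//.
  by rewrite mulrC; exact: moduli_near.
rewrite -normc_twist.
apply: (@phase_estimate _ a _ (normc c) s n) => //.
- exact: normc_ge0.
- rewrite -normc_conj conjcB conjcM conjc_real conjcK mulrC.
  exact: factor_product_near.
- by rewrite [_ + a]addrC.
- by rewrite normc_twist.
Qed.

End Factor.
End Pointwise.

(** * Factorization in C(X) *)

Section ApproximateFactorization.
Context {R : realType} {X : compactHausdorffType}.
Implicit Types f g h u v : contC R X.

Lemma continuous_modulus_of (P Q H : X -> R) :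
  continuous P -> continuous Q -> continuous H ->
  continuous (fun x => modulus_of (P x) (Q x) (H x)).
Proof.
move=> cP cQ cH; have cPQ := continuous_diffR cP cQ.
apply: continuous_prodR; last exact: cst_continuous.
apply: continuous_sumR => // x.
apply: (@continuous_comp _ _ _ (fun x => (P x - Q x) ^+ 2 + 4 * H x) Num.sqrt);
  last exact: sqrt_continuous.
apply: (continuous_sumR (continuous_prodR cPQ cPQ)).
by apply: continuous_prodR => //; exact: cst_continuous.
Qed.

Lemma continuous_inv_normc f : (forall x, f x != 0) ->
  continuous (fun x => (normc (f x))^-1).
Proof.
move=> f0 x; apply: (@continuousV R X (fun x => normc (f x))).
  by rewrite normc_eq0.
exact: continuous_normc.
Qed.

(** The tolerance [n] depends on [f] and [g], as [phase_estimate] requires [n]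
times their moduli to be at most [s^2]; this does no harm because [n] does not
enter the conclusion. *)
Lemma factor_zero_free f g h (s : R) : zero_free_dense R X -> 0 < s ->
    (forall x, h x != 0) -> (forall x, normc (h x - f x * g x) <= s ^+ 2) ->
  exists u v, [/\ u * v = h, forall x, normc (f x - u x) <= 5 * s &
    forall x, normc (g x - v x) <= 5 * s].
Proof.
move=> dX s0 h0 hfg.
have M0 : 0 < supnorm f + supnorm g + 10 * s.
  have := supnorm_ge0 f; have := supnorm_ge0 g; lra.
pose n := s ^+ 2 / (supnorm f + supnorm g + 10 * s).
have n0 : 0 < n by rewrite divr_gt0 ?exprn_gt0.
have nE : n * (supnorm f + supnorm g + 10 * s) = s ^+ 2.
  by rewrite /n divfK ?gt_eqF.
have nb (t : R) : t <= supnorm f + supnorm g + 10 * s -> t * n <= s ^+ 2.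
  by move=> tM; rewrite -nE mulrC ler_wpM2l// ltW.
have ns : 10 * n <= s.
  have : 10 * s * n <= s ^+ 2.
    by apply: nb; have := supnorm_ge0 f; have := supnorm_ge0 g; lra.
  by rewrite mulrAC expr2 ler_pM2r.
pose w := contC_real (continuous_inv_normc h0) * h.
have [F F0 hF] := dX (f + w * contC_conj g) n n0.
have cN k := @continuous_normc R X k.
have cr (P Q : contC R X) : continuous
    (fun x => modulus_of (normc (P x)) (normc (Q x)) (normc (h x)) / normc (F x)).
  apply: continuous_prodR (continuous_inv_normc F0).
  exact: continuous_modulus_of (cN P) (cN Q) (cN h).
have fn x : normc (f x) * n <= s ^+ 2.
  by apply: nb; have := normc_le_supnorm f x; have := supnorm_ge0 g; lra.
have gn x : normc (g x) * n <= s ^+ 2.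
  by apply: nb; have := normc_le_supnorm g x; have := supnorm_ge0 f; lra.
exists (contC_real (cr f g) * F), (contC_real (cr g f) * (w * contC_conj F)).
split.
- by apply: contC_eq => x; exact: factor_mul.
- by move=> x; exact:
    (factor_near_l s0 (ltW n0) ns (fn x) (hfg x) (h0 x) (F0 x) (hF x)).
- by move=> x; exact:
    (factor_near_r s0 (ltW n0) ns (gn x) (hfg x) (h0 x) (F0 x) (hF x)).
Qed.

(** The function [h] is replaced by one without zeros; the new discrepancy is at
most [2 (e / 10)^2 <= (e / 5)^2], which is the case [s = e / 5]. *)
Lemma factor_approx f g h (e n : R) : zero_free_dense R X -> 0 < e -> 0 < n ->
    (forall x, normc (h x - f x * g x) <= (e / 10) ^+ 2) ->
  exists u v, [/\ forall x, normc (f x - u x) <= e,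
    forall x, normc (g x - v x) <= e & forall x, normc (h x - u x * v x) <= n].
Proof.
move=> dX e0 n0 hfg.
have e2 : 0 < (e / 10) ^+ 2 by rewrite exprn_gt0//; lra.
have [k k0 hk] : exists2 k : contC R X, forall x, k x != 0 &
    forall x, normc (h x - k x) <= Num.min n ((e / 10) ^+ 2).
  by apply: dX; rewrite lt_min n0.
have s0 : 0 < e / 5 by lra.
have [x|u [v [uv fu gv]]] := @factor_zero_free f g k (e / 5) dX s0 k0.
  have -> : k x - f x * g x = (k x - h x) + (h x - f x * g x).
    by rewrite addrA subrK.
  apply: le_trans (ler_normcD _ _) _.
  have := hk x; rewrite le_min => /andP[_]; rewrite normcB.
  by have := hfg x; lra.
have e5 : 5 * (e / 5) = e by lra.
rewrite e5 in fu gv.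
exists u, v; split => // x.
by rewrite -contC_mulE uv; have := hk x; rewrite le_min => /andP[].
Qed.

End ApproximateFactorization.

Section Iteration.
Context {R : realType} {X : compactHausdorffType}.
Implicit Types f g h u v : contC R X.

Lemma halving_small (e t : R) : 0 < t -> exists n, e / 2 ^+ n <= t.
Proof.
move=> t0; have [e0|e0] := leP e 0.
  by exists 0; rewrite expr0 divr1; apply: le_trans e0 (ltW t0).
exists (Num.bound (e / t)).
have := archi_boundP (ltW (divr_gt0 e0 t0)); set n := Num.bound _ => en.
rewrite ler_pdivrMr ?exprn_gt0// mulrC -ler_pdivrMr//.
apply: le_trans (ltW en) _.
by rewrite -natrX ler_nat ltnW// ltn_expl.
Qed.

Lemma halving_limit (f : nat -> contC R X) (e : R) : 0 < e ->
    (forall n x, normc (f n x - f n.+1 x) <= e / 2 ^+ n) ->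
  exists l : contC R X, forall n x, normc (f n x - l x) <= 2 * e / 2 ^+ n.
Proof.
move=> e0 fS.
have p0 n : 0 < (2 : R) ^+ n by rewrite exprn_gt0.
have fD n m x : normc (f n x - f (n + m)%N x) <= 2 * e / 2 ^+ n.
  suff : normc (f n x - f (n + m)%N x) <= 2 * e / 2 ^+ n - 2 * e / 2 ^+ (n + m).
    move/le_trans; apply; rewrite lerBlDr lerDl.
    by rewrite divr_ge0 ?mulr_ge0 ?(ltW e0)// ltW.
  elim: m => [|m IH]; first by rewrite addn0 !subrr Normc.normc0.
  have -> : f n x - f (n + m.+1)%N x =
      (f n x - f (n + m)%N x) + (f (n + m)%N x - f (n + m.+1)%N x).
    by rewrite addrA subrK.
  apply: le_trans (ler_normcD _ _) _; rewrite addnS.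
  have := fS (n + m)%N x.
  have -> : e / 2 ^+ (n + m) = 2 * e / 2 ^+ (n + m).+1.
    by rewrite exprS invfM; field; rewrite gt_eqF.
  have : 2 * e / 2 ^+ (n + m) = 2 * (2 * e / 2 ^+ (n + m).+1).
    by rewrite exprS; field; rewrite gt_eqF.
  by move: IH; lra.
have /cvg_ex[l fl] : cvg (f @ \oo).
  apply: cauchy_cvg; apply: cauchy_exP => _ /complex_gt0[t t0 ->].
  have t20 : 0 < t / 2 by lra.
  have [n hn] := halving_small (2 * e) t20.
  exists (f n).
  suff : \forall m \near \oo, ball (f n) t%:C (f m) by [].
  near=> m; rewrite contC_ballE.
  apply: (@le_lt_trans _ _ (t / 2)); last by lra.
  apply: supnorm_le => [|x]; first by lra.
  have nm : (n <= m)%N by near: m; exact: nbhs_infty_ge.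
  by rewrite -(subnKC nm); apply: le_trans (fD _ _ _) hn.
exists l => n x; apply/ler_addgt0Pr => t t0.
have t0' : 0 < t%:C by rewrite ltcR.
have [N _ hN] := fl _ (nbhsx_ballx l t%:C t0').
have := hN (n + N)%N (leq_addl _ _); rewrite /= contC_ballE => hlf.
have -> : f n x - l x = (f n x - f (n + N)%N x) + (f (n + N)%N x - l x).
  by rewrite addrA subrK.
apply: le_trans (ler_normcD _ _) _; apply: lerD; first exact: fD.
rewrite normcB; apply: le_trans (normc_le_supnorm (l - f (n + N)%N) x) _.
exact: ltW.
Unshelve. all: by end_near. Qed.

(** At stage [n] the discrepancy is at most [(e_n / 10)^2] with
[e_n = e / 2^n]. A correction of size [e_n] brings it down to what stage [n + 1]
needs, so the corrected pairs converge, at a total distance at most [2 e], and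
the discrepancy vanishes in the limit. *)
Lemma factor_exact f g h (e : R) : zero_free_dense R X -> 0 < e ->
    (forall x, normc (h x - f x * g x) <= (e / 10) ^+ 2) ->
  exists u v, [/\ u * v = h, forall x, normc (f x - u x) <= 2 * e &
    forall x, normc (g x - v x) <= 2 * e].
Proof.
move=> dX e0 hfg.
pose good n (p : contC R X * contC R X) :=
  forall x, normc (h x - p.1 x * p.2 x) <= (e / 2 ^+ n / 10) ^+ 2.
have en0 n : 0 < e / 2 ^+ n by rewrite divr_gt0 ?exprn_gt0.
have /choice[step hstep] (np : nat * (contC R X * contC R X)) :
    exists q : contC R X * contC R X, good np.1 np.2 -> [/\ good np.1.+1 q,
      forall x, normc (np.2.1 x - q.1 x) <= e / 2 ^+ np.1 &
      forall x, normc (np.2.2 x - q.2 x) <= e / 2 ^+ np.1].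
  have [gd|] := pselect (good np.1 np.2); last by move=> ngd; exists np.2.
  have d0 : 0 < (e / 2 ^+ np.1.+1 / 10) ^+ 2.
    by rewrite exprn_gt0// divr_gt0.
  have [u [v [fu gv huv]]] := factor_approx dX (en0 np.1) d0 gd.
  by exists (u, v).
pose p := fix p n := if n is m.+1 then step (m, p m) else (f, g).
have gp n : good n (p n).
  elim: n => [|n IH]; first by move=> x; rewrite expr0 divr1.
  by have [] := hstep (n, p n) IH.
have [u hu] := @halving_limit (fun n => (p n).1) e e0
  (fun n => let: And3 _ h1 _ := hstep (n, p n) (gp n) in h1).
have [v hv] := @halving_limit (fun n => (p n).2) e e0
  (fun n => let: And3 _ _ h2 := hstep (n, p n) (gp n) in h2).
exists u, v; split; last 2 first.
- by move=> x; have := hu 0 x; rewrite expr0 divr1.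
- by move=> x; have := hv 0 x; rewrite expr0 divr1.
apply: contC_eq => x; apply/eqP; rewrite eq_sym -subr_eq0 -normc_eq0.
rewrite eq_le normc_ge0 andbT; apply/ler_addgt0Pr => t t0; rewrite add0r.
(* At a stage with [r = e_n <= 1], the discrepancy of the limit is at most
   [r^2 / 100 + (|u x| + 2 r) (2 r) + 2 r |v x| <= r K]. *)
pose K := 5 + 2 * normc (u x) + 2 * normc (v x).
have K0 : 0 < K.
  by rewrite /K; have := normc_ge0 (u x); have := normc_ge0 (v x); lra.
have m0 : 0 < Num.min 1 (t / K) by rewrite lt_min ltr01 divr_gt0.
have [n] := halving_small e m0.
rewrite le_min => /andP[r1]; rewrite ler_pdivlMr// => rK.
have := gp n x; have := hu n x; have := hv n x; have := en0 n.
have -> : 2 * e / 2 ^+ n = 2 * (e / 2 ^+ n) by rewrite mulrA.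
move: {+}(e / 2 ^+ n) r1 rK => r r1 rK.
set a := (p n).1 x; set b := (p n).2 x => r0 bv au hab.
rewrite contC_mulE.
have -> : h x - u x * v x =
    (h x - a * b) + (a * (b - v x) + (a - u x) * v x) by ring.
apply: le_trans (ler_normcD _ _) _.
have h1 := ler_normcD (a * (b - v x)) ((a - u x) * v x).
rewrite !Normc.normcM in h1.
have h2 : normc a <= normc (u x) + 2 * r.
  by have := ler_normcB a (u x); lra.
have h3 : normc a * normc (b - v x) <= (normc (u x) + 2 * r) * (2 * r).
  by apply: ler_pM; rewrite ?normc_ge0.
have h4 : normc (a - u x) * normc (v x) <= 2 * r * normc (v x).
  by rewrite ler_wpM2r ?normc_ge0.
have h5 : r * r <= r by rewrite ger_pMl.
apply: (@le_trans _ _ (r * K)) => //.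
by move: h1 h3 h4 h5 hab; rewrite /K; lra.
Qed.

Lemma mult_modulus_of_zero_free_dense (e : R) : zero_free_dense R X -> 0 < e ->
  mult_modulus (contC R X) e%:C ((e / 30) ^+ 2)%:C.
Proof.
move=> dX e0 [f g] h; rewrite /mulmap/= contC_ballE => hfg.
have [||u [v [uv fu gv]]] := @factor_exact f g h (e / 3) dX; first by lra.
  move=> x; rewrite normcB.
  apply: le_trans (normc_le_supnorm (bmul f g - h) x) _.
  apply: le_trans (ltW hfg) _.
  by have -> : e / 3 / 10 = e / 30 by field.
exists (u, v) => //.
have e3 : 2 * (e / 3) < e by lra.
by split; rewrite /= contC_ballE; apply: le_lt_trans e3;
  apply: supnorm_le => //; lra.
Qed.

End Iteration.

Lemma open_multiplication_of_uniform (K : numFieldType) (A : banachAlgType K) :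
  uniformly_open_multiplication A -> open_multiplication A.
Proof.
move=> uA U oU; rewrite openE => _ [p Up <-].
have /nbhs_ballP[e /= e0 eU] : nbhs p U by exact: open_nbhs_nbhs.
have [d d0 dA] := uA e e0.
apply/nbhs_ballP; exists d => //= y /dA[q pq <-].
by exists q => //; exact: eU.
Qed.

Lemma equi_modulus (R : realType) (e : R[i]) : 0 < e ->
  exists2 d : R[i], 0 < d & forall X : compactHausdorffType,
    zero_free_dense R X -> mult_modulus (contC R X) e d.
Proof.
move=> /complex_gt0[r r0 ->].
exists ((r / 30) ^+ 2)%:C; first by rewrite ltcR exprn_gt0// divr_gt0.
by move=> X dX; exact: mult_modulus_of_zero_free_dense.
Qed.

Theorem theoremC (R : realType) :
  (forall X : compactHausdorffType,
     [<-> open_multiplication (contC R X);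
          uniformly_open_multiplication (contC R X);
          covering_dim_le 1 X]) /\
  equi_uniformly_open_multiplications
    (fun X : {X : compactHausdorffType | covering_dim_le 1 X} =>
       contC R (sval X) : banachAlgType R[i]).
Proof.
have dense_of_dim (X : compactHausdorffType) :
    covering_dim_le 1 X -> zero_free_dense R X.
  by move=> /triples_shrink_of_dim; exact: zero_free_dense_of_triples.
have uniform_of_dense (X : compactHausdorffType) :
    zero_free_dense R X -> uniformly_open_multiplication (contC R X).
  by move=> dX e /equi_modulus[d d0 h]; exists d => //; exact: h.
split=> [X|e /equi_modulus[d d0 h]]; last first.
  by exists d => // -[X /= dX]; apply: h; exact: dense_of_dim.
split; first by move=> /zero_free_dense_of_open; exact: uniform_of_dense.
split.
  move=> /open_multiplication_of_uniform/zero_free_dense_of_open.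
  by move=> /triples_of_zero_free_dense; exact: dim_of_triples_shrink.
move=> /dense_of_dim/uniform_of_dense.
exact: open_multiplication_of_uniform.
Qed.
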